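(* Let $X$ be a completely regular Hausdorff space. Then $X$ is an almost $P$-space if and only if the following holds: a proper ideal $I$ of $C(X)$ is countable strongly annihilated if and only if it is a strongly divisible $z$-ideal (that is, the countable strongly annihilated proper ideals of $C(X)$ and the strongly divisible $z$-ideals of $C(X)$ coincide).
   Context: $C(X)$ is the ring of all continuous real-valued functions on $X$, and $Z(f)=\{x\in X: f(x)=0\}$ for $f\in C(X)$. The space $X$ is an almost $P$-space if for every $f\in C(X)$, $Z(f)\neq\emptyset$ implies $\mathrm{int}\,Z(f)\neq\emptyset$. An ideal $I$ of a commutative ring $R$ with unity is called countable strongly annihilated if for each countable subset $\{a_1,a_2,\ldots\}$ of $I$ and each $b\in R\setminus I$ there exists $c\in R$ such that $ca_n=0$ for all $n$ but $cb\neq 0$. An ideal $I$ of $R$ is strongly divisible if for all $a_1,a_2,\ldots\in I$ there exist $c\in I$ and $b_1,b_2,\ldots\in R$ such that $a_i=cb_i$ for $i=1,2,\ldots$. A proper ideal $I$ of $R$ is a $z$-ideal if for each $a\in I$ the intersection of all maximal ideals of $R$ containing $a$ is contained in $I$; in $C(X)$ this is equivalent to: whenever $f\in I$, $g\in C(X)$ and $Z(f)=Z(g)$, then $g\in I$. *)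

(* Defs.v *)
From HB Require Import structures.
From mathcomp Require Import all_boot all_order all_algebra.
From mathcomp Require Import all_classical all_reals topology normedtype.

Set Implicit Arguments.
Unset Strict Implicit.
Unset Printing Implicit Defensive.

Import GRing.Theory.
Import numFieldNormedType.Exports.

Local Open Scope classical_set_scope.
Local Open Scope ring_scope.

(* C(X) is the library type [continuousType X R] with the ring structure
   inherited from X -> R.  It is only a [comPzRingType]: X may be empty, in
   which case C(X) is the zero ring. *)
Section continuous_ring.
Context {X : topologicalType} {R : realType}.

Definition cfun : {pred X -> R} := mem [set f | continuous f].

Let cfun_Sub (f : X -> R) (fP : f \in cfun) : continuousType X R :=
  mkcts (set_mem fP).

Let cfun_rect (K : continuousType X R -> Type) :
  (forall f (fP : f \in cfun), K (cfun_Sub fP)) -> forall u, K u.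
Proof.
move=> Ksub u.
have uP : (u : X -> R) \in cfun by apply/mem_set; exact: cts_fun.
suff -> : u = cfun_Sub uP by exact: Ksub.
exact/continuousEP.
Qed.

HB.instance Definition _ :=
  @isSub.Build (X -> R) cfun (continuousType X R)
    (fun f => f : X -> R) cfun_Sub cfun_rect (fun _ _ => erefl).

Lemma cfun_subring_closed : subring_closed cfun.
Proof.
split=> [|f g /set_mem fc /set_mem gc|f g /set_mem fc /set_mem gc];
  apply/mem_set => x.
- exact: cvg_cst.
- by apply: cvgB; [exact: fc|exact: gc].
- by apply: cvgM; [exact: fc|exact: gc].
Qed.

HB.instance Definition _ :=
  GRing.SubChoice_isSubComPzRing.Build (X -> R) cfun (continuousType X R)
    cfun_subring_closed.

Implicit Types f g : continuousType X R.

Lemma cfun0E x : (0 : continuousType X R) x = 0. Proof. by []. Qed.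
Lemma cfun1E x : (1 : continuousType X R) x = 1. Proof. by []. Qed.
Lemma cfunNE f x : (- f) x = - f x. Proof. by []. Qed.
Lemma cfunDE f g x : (f + g) x = f x + g x. Proof. by []. Qed.
Lemma cfunME f g x : (f * g) x = f x * g x. Proof. by []. Qed.

Definition zero_set f : set X := [set x | f x = 0].

End continuous_ring.

Definition almost_P_space (R : realType) (X : topologicalType) :=
  forall f : continuousType X R, zero_set f !=set0 -> (zero_set f)° !=set0.

(* The library's [idealr] requires a nonzero ring and builds in properness. *)
Section ideals.
Context {A : comPzRingType}.
Implicit Types I M : set A.

Definition is_ideal I :=
  [/\ I 0, forall a b, I a -> I b -> I (a + b) & forall r a, I a -> I (r * a)].

Definition is_proper_ideal I := is_ideal I /\ I != setT.

Definition is_maximal_ideal M :=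
  is_proper_ideal M /\ forall J, is_proper_ideal J -> M `<=` J -> J = M.

Definition countable_strongly_annihilated I :=
  is_ideal I /\
  forall S : set A, countable S -> S `<=` I -> forall b, ~ I b ->
    exists c, (forall a, S a -> c * a = 0) /\ c * b <> 0.

Definition strongly_divisible I :=
  is_ideal I /\
  forall a : nat -> A, (forall i, I (a i)) ->
    exists c (b : nat -> A), I c /\ forall i, a i = c * b i.

Definition is_z_ideal I :=
  is_proper_ideal I /\
  forall a, I a -> \bigcap_(M in [set M | is_maximal_ideal M /\ M a]) M `<=` I.

End ideals.

(* Main.v *)
Require Import Defs.
From mathcomp Require Import all_boot all_order all_algebra.
From mathcomp Require Import all_classical all_reals topology normedtype.
From mathcomp Require Import interval_inference realfun ring.
Import numFieldNormedType.Exports.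
Import Order.TTheory GRing.Theory Num.Theory.

(** Both classes of ideals are compared with a third one, described by zero
    sets only: the ideals I such that b belongs to I as soon as Z(b) contains
    the intersection of the Z(a_i) for some sequence a_i in I
    ([countably_zero_set_closed]).

    On any space, a proper ideal is of this third kind exactly when it is a
    strongly divisible z-ideal ([strongly_divisible_z_idealP]).  The key is
    [common_divisor]: any sequence a_i in C(X) has a common divisor c that
    vanishes at all the common zeros of the a_i, so a zero-set-closed ideal
    containing the a_i contains c.

    On any space, a countable strongly annihilated ideal is of the third kind
    ([countable_strongly_annihilated_closed]): an annihilator of all the a_i
    lives on the common zeros of the a_i, hence kills every b that vanishes
    there.  The converse is where almost P-spaces enter
    ([closed_countable_strongly_annihilated]): if b is not in I, some point is
    a common zero of the a_i but not a zero of b; in an almost P-space one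
    finds such a point interior to the common zeros, and complete regularity
    gives a function equal to 1 there and supported in the common zeros.

    Conversely, the ideal of all functions vanishing at a point x of Z(f) is of
    the third kind, on any space.  If it is countable strongly annihilated,
    applying this to f and to b = 1 gives c <> 0 with c f = 0, and then f
    vanishes on the nonempty open set where c does not
    ([countable_strongly_annihilated_interior]). *)

Local Open Scope classical_set_scope.
Local Open Scope ring_scope.

(** * Ideals of commutative rings *)

Section ring_ideals.
Context {A : comPzRingType}.
Implicit Types I M : set A.

Lemma proper_ideal_not1 I : is_proper_ideal I -> ~ I 1.
Proof.
case=> -[_ _ IM] /eqP IT I1; apply: IT; rewrite -subTset => r _.
by rewrite -[r]mulr1; exact: IM.
Qed.

(** The ideal M + (b) strictly contains M, hence is the whole ring. *)
Lemma maximal_ideal_comaximal M b : is_maximal_ideal M -> ~ M b ->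
  exists m r, M m /\ m + r * b = 1.
Proof.
case=> -[[M0 MD MM] MT] Mmax Mb.
pose J := [set a | exists m r, M m /\ m + r * b = a].
have MJ : M `<=` J by move=> m Mm; exists m, 0; rewrite mul0r addr0.
have Jb : J b by exists 0, 1; rewrite add0r mul1r.
have idJ : is_ideal J.
  split; first exact: MJ.
  - move=> _ _ [m [r [Mm <-]]] [n [s [Mn <-]]].
    by exists (m + n), (r + s); split; [exact: MD|ring].
  - move=> t _ [m [r [Mm <-]]].
    by exists (t * m), (t * r); split; [exact: MM|ring].
have [JT|JT] := eqVneq J setT; first by have : J 1 by rewrite JT.
by case: Mb; rewrite -(Mmax J).
Qed.

(** The sequence is constantly 0 outside the image of S in nat, so that the
    case of an empty or finite S is covered as well. *)
Lemma countable_sub_range_seq I S : I 0 -> countable S -> S `<=` I ->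
  exists a : nat -> A, (forall i, I (a i)) /\ S `<=` range a.
Proof.
move=> I0 /countable_injP[f f_inj] SI.
exists (fun n => xget 0 [set s | S s /\ f s = n]); split.
  by move=> i; case: xgetP => [s _ [/SI]|].
move=> s Ss; exists (f s) => //; case: xgetP => [t _ [St ft]|/(_ s)[]//].
by apply: f_inj => //; exact/mem_set.
Qed.

End ring_ideals.

(** * Common divisors of sequences of continuous functions *)

Section zero_sets.
Context {R : realType} {X : topologicalType}.
Implicit Types (f g b c : continuousType X R) (a : nat -> continuousType X R).
Implicit Types I : set (continuousType X R).

Lemma cfunP f g : (forall x, f x = g x) -> f = g.
Proof. by move=> fg; apply/continuousEP. Qed.

Lemma ex_cfun (f : X -> R) : continuous f ->
  exists g : continuousType X R, forall x, g x = f x.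
Proof. by move=> fc; exists (mkcts fc). Qed.

Lemma ex_cfun_cst (r : R) : exists g : continuousType X R, forall x, g x = r.
Proof. by apply: ex_cfun => x; exact: cvg_cst. Qed.

Lemma ex_cfun_inv f : (forall x, f x != 0) -> exists g, f * g = 1.
Proof.
move=> f0; have [x|g gE] := ex_cfun (fun x => (f x)^-1).
  by apply: cvgV => //; exact: cts_fun.
by exists g; apply: cfunP => x; rewrite cfunME gE cfun1E mulfV.
Qed.

Lemma le_sup_vanishing (u : nat -> R) i :
  (forall j, 0 <= u j <= j.+1%:R^-1) -> u i <= sup (range u).
Proof.
move=> u_bound; apply: ub_le_sup; last by exists i.
exists 1 => _ [j _ <-]; have /andP[_ /le_trans] := u_bound j; apply.
by rewrite invf_le1 ?ler1n.
Qed.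

(** Near a given point and up to e, only the finitely many t_i with
    1 / (i + 1) > e matter, and these vary by at most e on a common
    neighbourhood. *)
Lemma continuous_sup_vanishing (t : nat -> X -> R) :
  (forall i, continuous (t i)) -> (forall i x, 0 <= t i x <= i.+1%:R^-1) ->
  continuous (fun x => sup (range (t^~ x))).
Proof.
move=> tc tb; set s := fun x => _.
have t_le i x : t i x <= s x by exact: (le_sup_vanishing (t^~ x)).
have s_ge0 x : 0 <= s x by apply: le_trans (t_le 0%N x); case/andP: (tb 0%N x).
have s_le x r : (forall i, t i x <= r) -> s x <= r.
  by move=> tr; apply: ge_sup => [|_ [i _ <-]//]; exists (t 0%N x), 0%N.
move=> x; apply/cvgrPdist_le => e e0.
have [N Ne] : exists N : nat, N.+1%:R^-1 <= e.
  near \oo%classic => N; exists N; apply/ltW; near: N.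
  exact: (near_infty_natSinv_lt (PosNum e0)).
have : \forall y \near x, forall i : 'I_N, `|t i x - t i y| <= e.
  apply: filter_forall => i; have /cvgrPdist_le := tc i x; exact.
apply: filterS => y near_t.
have tail i z w : (N <= i)%N -> t i z <= s w + e.
  move=> Ni; have /andP[_ /le_trans] := tb i z; apply.
  apply: (@le_trans _ _ e); last by rewrite lerDr.
  by apply: le_trans Ne; rewrite lef_pV2 ?posrE// ler_nat ltnS.
have half z w : (forall i : 'I_N, t i z <= t i w + e) -> s z <= s w + e.
  move=> tzw; apply: s_le => i; have [iN|/tail//] := ltnP i N.
  by apply: le_trans (tzw (Ordinal iN)) _; rewrite lerD2r t_le.
rewrite ler_distlC lerBlDr; apply/andP; split; apply: half => i;
  have := near_t i; rewrite ler_distlC lerBlDr => /andP[]//.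
Unshelve. all: by end_near. Qed.

(** The divisor is c = sqrt(s) with s the supremum over i of
    min(1 / (i + 1), |a_i|).  The truncation makes s finite and continuous.
    Near a zero of c one has |a_i| < 1 / (i + 1), hence |a_i| <= s = c ^ 2, so
    the quotient a_i / c is bounded by c and extends continuously by 0: this is
    what the square root is for. *)
Lemma common_divisor a : exists c (b : nat -> continuousType X R),
  (forall i, a i = c * b i) /\ \bigcap_i zero_set (a i) `<=` zero_set c.
Proof.
pose t i x := Num.min (i.+1%:R^-1) `|a i x|.
have t_bound i x : 0 <= t i x <= i.+1%:R^-1.
  by rewrite le_min invr_ge0 ler0n normr_ge0 ge_min lexx.
have t_cont i : continuous (t i).
  move=> x; apply: (@continuous_min R X (fun=> i.+1%:R^-1)); first exact: cvg_cst.
  by apply: cvg_norm; exact: cts_fun.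
have s_cont := continuous_sup_vanishing t t_cont t_bound.
pose s x := sup (range (t^~ x)).
have t_le i x : t i x <= s x by exact: (le_sup_vanishing (t^~ x)).
have s_ge0 x : 0 <= s x.
  by apply: le_trans (t_le 0%N x); case/andP: (t_bound 0%N x).
have [x|c cE] := ex_cfun (fun x => Num.sqrt (s x)).
  by apply: continuous_comp; [exact: s_cont|exact: sqrt_continuous].
have c0_a0 i x : c x = 0 -> a i x = 0.
  rewrite cE => /eqP; rewrite sqrtr_eq0 => s0.
  have := le_trans (t_le i x) s0.
  by rewrite ge_min leNgt invr_gt0 ltr0n/= normr_le0 => /eqP.
have b_cont i : continuous (fun x => a i x / c x).
  move=> x; have [cx0|cx0] := eqVneq (c x) 0; last first.
    by apply: cvgM; [exact: cts_fun|apply: cvgV => //; exact: cts_fun].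
  (* At a zero of c the quotient takes the value 0, since 0^-1 = 0. *)
  rewrite /continuous_at cx0 invr0 mulr0.
  apply/cvgr0Pnorm_le => e e0.
  have : c @ x --> (0 : R) by rewrite -cx0; exact: cts_fun.
  move/cvgr0Pnorm_le => /(_ _ e0) c_small.
  have : a i @ x --> (0 : R) by rewrite -(c0_a0 i x cx0); exact: cts_fun.
  have /[swap] /cvgr0Pnorm_lt/[apply] a_small : (0 : R) < i.+1%:R^-1.
    by rewrite invr_gt0.
  near=> y.
  have ay : `|a i y| < i.+1%:R^-1 by near: y.
  have cy : `|c y| <= e by near: y.
  apply: le_trans cy; have [->|cy0] := eqVneq (c y) 0.
    by rewrite invr0 mulr0 normr0.
  rewrite normrM normfV ler_pdivrMr ?normr_gt0// -expr2 real_normK ?num_real//.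
  rewrite cE sqr_sqrtr//; apply: le_trans (t_le i y).
  by rewrite le_min lexx ltW.
have [b bE] := choice (fun i => ex_cfun _ (b_cont i)).
exists c, b; split=> [i|x a0].
  apply: cfunP => x; rewrite cfunME bE mulrC.
  by have [/[dup]/c0_a0-> ->|cx0] := eqVneq (c x) 0; rewrite ?mulr0// divfK.
rewrite /zero_set/= cE.
have -> : s x = 0; last by rewrite sqrtr0.
apply/eqP; rewrite eq_le s_ge0 andbT; apply: ge_sup; first by exists (t 0%N x), 0%N.
by move=> _ [i _ <-]; rewrite /t (a0 i I) normr0 ge_min lexx orbT.
Unshelve. all: by end_near. Qed.

(** * Strongly divisible z-ideals and zero sets *)

Definition countably_zero_set_closed I := forall a b,
  (forall i, I (a i)) -> \bigcap_i zero_set (a i) `<=` zero_set b -> I b.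

Definition point_ideal (x : X) : set (continuousType X R) := [set f | f x = 0].

Lemma point_ideal_proper x : is_proper_ideal (point_ideal x).
Proof.
split; first split => [|f g fx gx|r f fx]; rewrite /point_ideal/=.
- exact: cfun0E.
- by rewrite cfunDE fx gx addr0.
- by rewrite cfunME fx mulr0.
- apply/eqP => /seteqP[_ /(_ 1 I)]; rewrite /point_ideal/= cfun1E.
  exact/eqP/oner_neq0.
Qed.

(** If f(x) <> 0, then 1 - f / f(x) vanishes at x, so 1 lies in any ideal that
    contains f and all functions vanishing at x. *)
Lemma point_ideal_maximal x : is_maximal_ideal (point_ideal x).
Proof.
split=> [|J Jproper subJ]; first exact: point_ideal_proper.
apply/seteqP; split=> // f Jf; apply: contrapT => /eqP fx0.
have [k kE] := ex_cfun_cst (f x)^-1.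
case: (Jproper) => -[_ JD JM] _; apply: (proper_ideal_not1 J Jproper).
rewrite -[1](subrK (k * f)); apply: JD; last exact: JM.
by apply: subJ; rewrite /point_ideal/= cfunDE cfunNE cfunME cfun1E kE mulVf ?subrr.
Qed.

(** Otherwise m + r b = 1 with m in M; then c ^ 2 + m ^ 2 lies in M but has no
    zero, since b vanishes wherever c does: it is a unit. *)
Lemma maximal_ideal_zero_set (M : set (continuousType X R)) c b :
  is_maximal_ideal M -> M c -> zero_set c `<=` zero_set b -> M b.
Proof.
move=> Mmax Mc cb; apply: contrapT => /(maximal_ideal_comaximal M b Mmax).
have [Mproper _] := Mmax; have [[_ MD MM] _] := Mproper.
move=> [m [r [Mm mE]]].
have [x|g cmg] := ex_cfun_inv (c * c + m * m).
  rewrite cfunDE !cfunME -!expr2 paddr_eq0 ?sqr_ge0// !sqrf_eq0.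
  apply/negP => /andP[/eqP cx /eqP mx].
  have /eqP := congr1 (fun f : continuousType X R => f x) mE.
  rewrite /= cfunDE cfunME cfun1E mx [b x](cb x cx) mulr0 addr0.
  by rewrite eq_sym oner_eq0.
apply: (proper_ideal_not1 M Mproper); rewrite -cmg mulrC.
by apply/MM/MD; exact: MM.
Qed.

Lemma z_ideal_zero_set I c b :
  is_z_ideal I -> I c -> zero_set c `<=` zero_set b -> I b.
Proof.
move=> [_ Iz] Ic cb; apply: (Iz c Ic) => M [Mmax Mc].
exact: maximal_ideal_zero_set Mmax Mc cb.
Qed.

(** A divisor in I of all the a_i reduces the closure condition to a single
    zero set, where it is the z-ideal property.  In the other direction,
    [common_divisor] provides the divisor, and the maximal ideals of points
    suffice to recover the inclusion between zero sets. *)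
Lemma strongly_divisible_z_idealP I : is_proper_ideal I ->
  strongly_divisible I /\ is_z_ideal I <-> countably_zero_set_closed I.
Proof.
move=> Iproper; split=> [[[_ Idiv] Iz] a b Ia ab|Iclosed].
  have [c [d [Ic aE]]] := Idiv a Ia.
  apply: (z_ideal_zero_set I c b Iz Ic) => x cx; apply: ab => i _.
  by rewrite /zero_set/= aE cfunME cx mul0r.
split; split=> //; first by case: Iproper.
- move=> a Ia; have [c [b [aE ac]]] := common_divisor a.
  by exists c, b; split=> //; exact: Iclosed Ia ac.
- move=> a Ia b bM; apply: (Iclosed (fun=> a)) => // x /(_ 0%N Logic.I) ax.
  by apply: (bM (point_ideal x)); split=> //; exact: point_ideal_maximal.
Qed.

(** * Annihilators *)

Lemma countable_strongly_annihilated_closed I :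
  countable_strongly_annihilated I -> countably_zero_set_closed I.
Proof.
move=> [_ Iann] a b Ia ab; apply: contrapT => Ib.
have [||c [ca cb]] := Iann (range a) _ _ b Ib.
- exact: card_image_le.
- by move=> _ [i _ <-].
apply: cb; apply: cfunP => x; rewrite cfunME cfun0E.
have [->|cx0] := eqVneq (c x) 0; first by rewrite mul0r.
rewrite [b x](ab x) ?mulr0// => i _; apply/eqP.
have /eqP := congr1 (fun f : continuousType X R => f x) (ca (a i) (imageT _ _)).
by rewrite /= cfunME cfun0E mulf_eq0 (negPf cx0).
Qed.

Lemma closed_countable_strongly_annihilated I :
  completely_regular_space X -> almost_P_space R X ->
  is_ideal I -> countably_zero_set_closed I -> countable_strongly_annihilated I.
Proof.
move=> X_creg X_aP Iid Iclosed; split=> // S Scount SI b Ib.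
have [I0 _ _] := Iid.
have [a [Ia Sa]] := countable_sub_range_seq I S I0 Scount SI.
have [c [q [aE ac]]] := common_divisor a.
have [x ax bx0] : exists2 x, (forall i, a i x = 0) & b x <> 0.
  apply: contrapT => nx; apply: Ib; apply: (Iclosed a b Ia) => x ax.
  by apply: contrapT => bx; apply: nx; exists x => // i; exact: ax.
have [k kE] := ex_cfun_cst (b x).
(* Z(f) is the part of Z(c) on which b keeps its nonzero value b(x). *)
pose f := c * c + (b - k) * (b - k).
have fE y : f y = c y ^+ 2 + (b y - b x) ^+ 2.
  by rewrite cfunDE !cfunME cfunDE cfunNE kE.
have f0 y : f y = 0 -> c y = 0 /\ b y = b x.
  move/eqP; rewrite fE paddr_eq0 ?sqr_ge0// !sqrf_eq0 subr_eq0.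
  by move=> /andP[/eqP ? /eqP].
have cx : c x = 0 by apply: (ac x) => i _; exact: ax.
have [|y fy] := X_aP f.
  by exists x; rewrite /zero_set/= fE cx subrr expr0n addr0.
have cy : (zero_set c)° y by apply: interiorS fy => z /f0[].
have by0 : b y <> 0.
  by have /f0[_ ->] : f y = 0 by exact: (interior_subset fy).
have /(@uniform_separatorP X R)[h [hc _ h0 h1]] :
    uniform_separator [set y] (~` (zero_set c)°).
  by apply: X_creg; [exact/open_closedC/open_interior|exact].
have [d dE] := ex_cfun h hc.
exists (1 - d); split=> [s /Sa[i _ <-]|/(congr1 (fun g : continuousType X R => g y))].
  apply: cfunP => z; rewrite aE !cfunME cfunDE cfunNE cfun1E cfun0E dE.
  have [/interior_subset->|cz] := pselect ((zero_set c)° z).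
    by rewrite mul0r mulr0.
  by have -> : h z = 1 by [apply: h1; exists z]; rewrite subrr mul0r.
rewrite /= cfunME cfunDE cfunNE cfun1E cfun0E dE.
by have -> : h y = 0 by [apply: h0; exists y]; rewrite subr0 mul1r.
Qed.

Lemma point_ideal_closed x : countably_zero_set_closed (point_ideal x).
Proof. by move=> a b ax ab; apply: ab => i _; exact: ax. Qed.

(** Annihilating f but not 1 gives c <> 0 with c f = 0: f vanishes on the
    nonempty open set where c does not. *)
Lemma countable_strongly_annihilated_interior I f :
  is_proper_ideal I -> countable_strongly_annihilated I -> I f ->
  (zero_set f)° !=set0.
Proof.
move=> Iproper [_ Iann] If.
have [||c [cf c1]] := Iann [set f] _ _ 1 (proper_ideal_not1 I Iproper).
- exact: countable1.
- by move=> _ ->.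
have [x cx] : exists x, c x <> 0.
  apply: contrapT => nx; apply: c1; rewrite mulr1; apply: cfunP => x.
  by apply: contrapT => cx; apply: nx; exists x.
exists x; rewrite /interior/=.
have /cvgr_neq0/(_ (introN eqP cx)) : c @ x --> c x by exact: cts_fun.
apply: filterS => y cy; apply/eqP.
have /eqP := congr1 (fun g : continuousType X R => g y) (cf f erefl).
by rewrite /= cfunME cfun0E mulf_eq0 (negPf cy).
Qed.

End zero_sets.

Theorem proposition4p2 (R : realType) (X : topologicalType)
    (X_creg : completely_regular_space X) (X_haus : hausdorff_space X) :
  almost_P_space R X <->
  (forall I : set (continuousType X R), is_proper_ideal I ->
    (countable_strongly_annihilated I <-> strongly_divisible I /\ is_z_ideal I)).
Proof.
split=> [X_aP I Iproper|IannP f [x fx]].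
  rewrite strongly_divisible_z_idealP//; split.
    exact: countable_strongly_annihilated_closed.
  by apply: closed_countable_strongly_annihilated => //; case: Iproper.
have Mproper := point_ideal_proper (R := R) x.
apply: (countable_strongly_annihilated_interior _ _ Mproper) fx.
by apply/IannP/strongly_divisible_z_idealP => //; exact: point_ideal_closed.
Qed.
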